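(* Let $k\ge 2$ and $0\le l<k\le n$ be integers. If $T$ is a tree with $n$ vertices and $p\ge 2$ leaves, then $\bar{\varepsilon}_{k,l}(T)\le \bar{\varepsilon}_{k,l}(B(n,p))$.
   Context: For a tree $G$ and $S\subseteq V(G)$, $d_G(S)$ is the number of edges of the minimal subtree of $G$ containing $S$. For an $l$-subset $S$ of $V(G)$ ($n=|V(G)|$), $\varepsilon_{k,l}(S;G)=\max\{d_G(S'): S\subseteq S'\subseteq V(G),\ |S'|=k\}$, and $\bar{\varepsilon}_{k,l}(G)=\binom{n}{l}^{-1}\sum_{|S|=l}\varepsilon_{k,l}(S;G)$. The broom $B(n,p)$ is the tree of order $n$ consisting of a vertex $c$ with $p-1$ pendant edges and one pendant path of length $n-p$ (equivalently, the star $K_{1,p}$ with one leaf identified with an endpoint of a path on $n-p$ vertices); it has $p$ leaves. *)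

(* Defs.v *)
From mathcomp Require Import all_boot all_order all_algebra.

Set Implicit Arguments.
Unset Strict Implicit.
Unset Printing Implicit Defensive.

Import Order.TTheory GRing.Theory Num.Theory.

Section Graphs.

Variable V : finType.

(* A graph is a vertex set U : {set V} together with an edge set
   E : {set {set V}} of two-element subsets of U, so that subgraphs of a graph
   on V are again graphs in the same sense. *)
Implicit Types (U W S : {set V}) (E F : {set {set V}}).

Definition is_graph U E : bool :=
  [forall A in E, (#|A| == 2) && (A \subset U)].

Definition adj E : rel V := [rel x y | [set x; y] \in E].

Definition connected_graph U E : bool :=
  [forall x in U, forall y in U, connect (adj E) x y].

(* A duplicate-free sequence over V has length at most #|V|, so the bound on m
   loses no cycle. *)
Definition acyclic_graph E : bool :=
  ~~ [exists m : 'I_#|V|.+1, exists c : m.-tuple V,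
        (2 < m) && ucycleb (adj E) c].

Definition is_tree U E : bool :=
  [&& U != set0, is_graph U E, connected_graph U E & acyclic_graph E].

Definition leaves E : {set V} := [set x | #|[set y | adj E x y]| == 1].

Definition is_subtree E W F : bool := (F \subset E) && is_tree W F.

(* The default value #|E| of the minimum is attained by E itself when E is the
   edge set of a tree on V. *)
Definition steiner_dist E S : nat :=
  \big[minn/#|E|]_(H : {set V} * {set {set V}}
                    | is_subtree E H.1 H.2 && (S \subset H.1)) #|H.2|.

Definition steiner_ecc (k : nat) E S : nat :=
  \max_(S' : {set V} | (S \subset S') && (#|S'| == k)) steiner_dist E S'.

Definition avg_steiner_ecc (k l : nat) E : rat :=
  ((\sum_(S : {set V} | #|S| == l) steiner_ecc k E S)%N%:R
     / 'C(#|V|, l)%:R)%R.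

End Graphs.

(* The centre is 0, its pendant neighbours are 1, ..., p - 1, and the pendant
   path of length n - p is 0, p, p + 1, ..., n - 1. *)
Definition broom_edge (p i j : nat) : bool :=
  [&& i == 0, 0 < j & j <= p] || [&& p <= i & j == i.+1].

Definition broom (n p : nat) : {set {set 'I_n}} :=
  [set A : {set 'I_n} | [exists i : 'I_n, exists j : 'I_n,
                           broom_edge p i j && (A == [set i; j])]].

(* Main.v *)
Require Import Defs.
From mathcomp Require Import all_boot all_order all_algebra zify.

Set Implicit Arguments.
Unset Strict Implicit.
Unset Printing Implicit Defensive.

(* The comparison holds set by set: for a suitable bijection f from the
   vertices of the broom B(n, p) to those of T, every S satisfies
   eps_T (f S) <= eps_B S.  A tree spanned by S' misses every leaf outside S',
   so eps_T S <= n - 1 - (p - a - (k - l)) (truncated), where a is the number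
   of leaves in S; if f preserves leaves, the broom attains this bound, except
   when k = l + 1 and a = 0.  In that case S lies in the inner tree, a tree on
   q = n - p vertices, against a path on q vertices in the broom.  Peel the
   inner tree by removing two leaves at a time, and let f send the i-th pair to
   the i-th vertices from both ends of the path.  An extra vertex recovers at
   most one vertex of each peeled pair, so if S contains the vertex in position
   j (from 0), then eps_T S <= max (q - j, j + 1), and the extension of S by
   one of the two kinds of leaves of the broom reaches at least this value. *)

Lemma subset_card_between (T : finType) (X Y : {set T}) k :
  X \subset Y -> #|X| <= k -> k <= #|Y| ->
  exists Z : {set T}, [/\ X \subset Z, Z \subset Y & #|Z| = k].
Proof.
move=> sXY; elim: k => [|k IHk] leXk lekY.
  by exists X; split=> //; apply/eqP; rewrite -leqn0.
move: leXk; rewrite leq_eqVlt => /orP[/eqP <-|ltXk]; first by exists X.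
have [Z [sXZ sZY cardZ]] := IHk ltXk (ltnW lekY).
have /properP[_ [y yY yNZ]] : Z \proper Y.
  by rewrite properEcard sZY cardZ lekY.
exists (y |: Z); split.
- exact: subset_trans sXZ (subsetUr _ _).
- by rewrite subUset sub1set yY.
- by rewrite cardsU1 yNZ cardZ.
Qed.

(** Arithmetic of one peeling step: putting back a pair of leaves raises the order of the tree by
    two and every index by one, so the bound gains one. *)
Lemma maxn_shift w i u :
  w <= maxn (u - i) i.+1 -> w < maxn (u.+2 - i.+1) i.+2.
Proof. lia. Qed.

(** * Connected induced subgraphs *)

Section InducedConnectivity.

Variables (V : finType) (e : rel V).
Hypothesis e_sym : symmetric e.
Hypothesis e_irr : irreflexive e.
Implicit Types W : {set V}.

Definition restrict_rel (W : {set V}) : rel V :=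
  [rel x y | [&& x \in W, y \in W & e x y]].

(** Vacuous for the empty set, hence the separate nonemptiness assumptions on [W] further on. *)
Definition conn (W : {set V}) : Prop :=
  {in W &, forall x y, connect (restrict_rel W) x y}.

Definition nbr (W : {set V}) (x : V) : {set V} := [set y in W | e x y].

Lemma path_restrict_mem W x p :
  path (restrict_rel W) x p -> {subset p <= W}.
Proof.
elim: p x => [|y p IHp] x //= /andP[/and3P[_ yW _] pth] z.
by rewrite inE => /predU1P[-> //|]; apply: IHp pth z.
Qed.

Lemma path_restrict W x p :
  x \in W -> path (restrict_rel W) x p = (path e x p && all (mem W) p).
Proof.
elim: p x => [|y p IHp] x xW //=; rewrite /restrict_rel /= xW.
by case: (boolP (y \in W)) => yW /=; rewrite ?andbF // IHp // andbA.
Qed.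

Lemma conn_first_step W x s :
  conn W -> x \in W -> s \in W -> s != x -> exists2 z, z \in W & e x z.
Proof.
move=> cW xW sW sx; have /connectP[[|z p] /= pth sE] := cW x s xW sW.
  by rewrite sE eqxx in sx.
by case/andP: pth => /and3P[_ zW exz] _; exists z.
Qed.

(* An inner vertex of a simple path has two neighbours on it, so a simple
   path between surviving vertices avoids R. *)
Lemma connD W (R : {set V}) :
  conn W -> {in R, forall x, #|nbr W x| <= 1} -> conn (W :\: R).
Proof.
move=> cW degR x y; rewrite !inE => /andP[xR xW] /andP[yR yW].
have /connectP[p0 /shortenP[p pth Up _] yE] := cW x y xW yW.
have pW := path_restrict_mem pth.
move: pth; rewrite path_restrict // => /andP[pth _].
apply/connectP; exists p => //; rewrite path_restrict ?inE ?xR //.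
rewrite pth /=; apply/allP => z zp /=; rewrite !inE pW // andbT.
apply/negP => zR; have := degR z zR.
case/splitPr: zp pth Up yE pW => p1 [|b p2] pth Up yE pW.
  by rewrite yE last_cat /= zR in yR.
move: pth; rewrite cat_path /= => /and4P[_ ez eb _].
set a := last x p1 in ez.
have aU : a \in x :: p1 by rewrite mem_last.
have ab : a != b.
  apply: contraTneq Up => ab; rewrite -cat_cons cat_uniq.
  apply/negP => /and3P[_ /hasP[]].
  by exists b; rewrite ?inE ?eqxx ?orbT -?ab.
have aW : a \in W.
  by move: aU; rewrite inE => /predU1P[-> //|ap]; rewrite pW // mem_cat ap.
have bW : b \in W by rewrite pW // mem_cat !inE eqxx !orbT.
rewrite leqNgt => /negP; apply; apply/card_gt1P; exists a, b.
by rewrite !inE aW bW e_sym ez eb ab.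
Qed.

Lemma connD1 W x : conn W -> #|nbr W x| <= 1 -> conn (W :\ x).
Proof. by move=> cW dx; apply: connD => // _ /set1P->. Qed.

Lemma connU1 W x z : conn W -> z \in W -> e x z -> conn (x |: W).
Proof.
move=> cW zW exz.
have sub a b : connect (restrict_rel W) a b ->
    connect (restrict_rel (x |: W)) a b.
  apply: connect_sub => {}a {}b /and3P[aW bW eab]; apply: connect1.
  by rewrite /restrict_rel /= !inE aW bW eab !orbT.
have xz : connect (restrict_rel (x |: W)) x z.
  by apply: connect1; rewrite /restrict_rel /= !inE eqxx zW exz orbT.
have zx : connect (restrict_rel (x |: W)) z x.
  by apply: connect1; rewrite /restrict_rel /= !inE eqxx zW e_sym exz orbT.
move=> a b /setU1P[->|aW] /setU1P[->|bW] //.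
- exact: connect_trans xz (sub _ _ (cW _ _ zW bW)).
- exact: connect_trans (sub _ _ (cW _ _ aW zW)) zx.
- exact: sub (cW _ _ aW bW).
Qed.

Hypothesis e_acyclic : forall c, 2 < size c -> ~~ ucycleb e c.

(** Two neighbours of the end [x] would both lie on the path; the one that is not the successor of
    [x] closes a cycle. *)
Lemma maximal_path_end W x p :
  path e x p -> uniq (x :: p) ->
  {in nbr W x, forall y, y \in x :: p} -> #|nbr W x| <= 1.
Proof.
move=> pth Up maxp; rewrite leqNgt; apply/negP => /card_gt1P[a [b [aN bN nab]]].
have [exa exb] : e x a /\ e x b.
  by move: aN bN; rewrite !inE => /andP[_ ->] /andP[_ ->].
case: p pth Up maxp => [|z p] pth Up maxp.
  by move: (maxp a aN); rewrite inE => /eqP ax; rewrite ax e_irr in exa.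
(* Choosing [y] different from the successor [z] makes the cycle [x], [z], ..., [y] have at least
   three vertices. *)
have [y [yN exy nyz]] : exists y, [/\ y \in nbr W x, e x y & y != z].
  have [az|az] := eqVneq a z; last by exists a.
  by exists b; rewrite -az eq_sym.
have yp : y \in p.
  move: (maxp y yN); rewrite !inE (negbTE nyz) => /orP[/eqP yx|//].
  by rewrite yx e_irr in exy.
case/splitPr: yp pth Up {maxp} => p1 p2 pth Up.
suff: ucycleb e (x :: z :: rcons p1 y).
  by apply/negP/e_acyclic; rewrite /= size_rcons.
rewrite -cat_rcons -!cat_cons in pth Up.
move: pth Up; rewrite cat_path cat_uniq => /andP[pth _] /andP[Up _].
rewrite /ucycleb Up andbT (cycle_path x) /= last_rcons e_sym exy.
exact: pth.
Qed.

(** The two ends of a longest simple path inside [W] will do: a neighbour in [W] off the path would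
    extend it. *)
Lemma exists_two_leaves W :
  conn W -> 1 < #|W| ->
  exists x y, [/\ x \in W, y \in W, x != y, #|nbr W x| <= 1 & #|nbr W y| <= 1].
Proof.
move=> cW /card_gt1P[a [b [aW bW nab]]].
pose P n := [exists t : n.-tuple V,
  if tval t is x :: p then
    [&& path e x p, uniq (x :: p) & all (mem W) (x :: p)] else false].
have [c cWW eac] : exists2 c, c \in W & e a c.
  by apply: (conn_first_step cW aW bW); rewrite eq_sym.
have nac : a != c by apply: contraTneq eac => ->; rewrite e_irr.
(* A single edge is already such a path, so the longest one has two distinct ends. *)
have P2 : P 2.
  apply/existsP; exists [tuple a; c].
  by rewrite /= eac aW cWW inE nac.
have Pmax n : P n -> n <= #|V|.
  case/existsP => [[[|x p] /= /eqP sz]] // /and3P[_ Up _].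
  have /card_uniqP := (Up : uniq (x :: p)); rewrite /= sz => <-.
  exact: max_card.
have Pseq x p : path e x p -> uniq (x :: p) -> all (mem W) (x :: p) ->
    P (size p).+1.
  by move=> pth Up aWp; apply/existsP; exists (in_tuple (x :: p)); apply/and3P.
case: (ex_maxnP (ex_intro _ 2 P2) Pmax) => n Pn maxn.
case/existsP: Pn => [[[|x p] /= /eqP sz]] // /and3P[pth Up aWp].
have p0 : 0 < size p by have := maxn _ P2; rewrite -sz.
have endP u r : path e u r -> uniq (u :: r) -> all (mem W) (u :: r) ->
    size r = size p -> #|nbr W u| <= 1.
  move=> pthu Uu aWu szu; apply: (maximal_path_end pthu Uu) => y yN.
  apply/negPn/negP => yNu; move: yN; rewrite inE => /andP[yW euy].
  suff: P (size r).+2 by move/maxn; rewrite -sz szu ltnn.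
  apply: (@Pseq y (u :: r)) => /=.
  - by rewrite e_sym euy.
  - by rewrite yNu.
  - by rewrite yW.
exists x, (last x p); have /andP[xW pW] := aWp; split=> //.
- exact: (allP (aWp : all (mem W) (x :: p)) _ (mem_last x p)).
- case: (p) p0 Up => // z r _ /= /andP[xNr _].
  by apply: contraNneq xNr => ->; rewrite mem_last.
- exact: endP pth Up aWp erefl.
(* The last vertex is the first one of the reversed path. *)
- have revE : last x p :: rev (belast x p) = rev (x :: p).
    by rewrite [x :: p]lastI rev_rcons.
  apply: (endP _ (rev (belast x p))).
  + by rewrite rev_path (eq_path (e' := e)).
  + by rewrite revE rev_uniq.
  + by rewrite revE all_rev.
  + by rewrite size_rev size_belast.
Qed.

Lemma conn_attach W x s :
  conn (x |: W) -> x \notin W -> s \in W -> exists2 z, z \in W & e x z.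
Proof.
move=> cW xW sW; have sx : s != x by apply: contraNneq xW => <-.
have [||z /setU1P[->|zW] exz] := conn_first_step cW _ _ sx;
  rewrite ?inE ?eqxx ?sW ?orbT //.
  by rewrite e_irr in exz.
by exists z.
Qed.

(* Repeatedly removing two leaves and writing them at both ends of s orders U
   so that a set S avoiding the first and last i vertices of s is reached by
   every v within a subtree omitting i vertices: at each stage v lies on at
   most one of the two removed leaves. *)
Lemma exists_peeling (U : {set V}) : conn U ->
  exists s : seq V, [/\ uniq s, s =i U &
    forall (S : {set V}) v, S \subset U -> S != set0 -> v \in U ->
    exists W a, [/\ conn W, v |: S \subset W, a \in S &
      #|W| <= maxn (#|U| - index a s) (index a s).+1]].
Proof.
have [n] := ubnP #|U|; elim: n U => // n IHn U ltUn cU.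
have [U1|U2] := leqP #|U| 1.
  exists (enum U); split=> [||S v sSU /set0Pn[a aS] vU].
  - exact: enum_uniq.
  - exact: mem_enum.
  exists U, a; split=> //; first by rewrite subUset sub1set vU.
  have aU := subsetP sSU a aS.
  have := index_mem a (enum U); rewrite mem_enum aU -cardE => /idP.
  by rewrite leq_max; move: U1; lia.
have [x [y [xU yU nxy dx dy]]] := exists_two_leaves cU U2.
pose U' := U :\: [set x; y].
have sxyU : [set x; y] \subset U by rewrite subUset !sub1set xU.
have cardU' : #|U| = #|U'|.+2.
  have := cardsID [set x; y] U.
  by rewrite (setIidPr sxyU) cards2 nxy add2n => <-.
have cU' : conn U' by apply: connD => // z /set2P[] ->.
have [|s [Us sE peel]] := IHn U' _ cU'; first by move: ltUn; lia.
have xs : x \notin s by rewrite sE !inE eqxx.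
have ys : y \notin s by rewrite sE !inE eqxx orbT.
have sz : size s = #|U'| by rewrite -(card_uniqP Us); apply: eq_card.
exists (x :: rcons s y); split=> [|z|S v sSU S0 vU].
- by rewrite /= rcons_uniq mem_rcons inE negb_or nxy xs ys Us.
- rewrite !(inE, mem_rcons) sE !inE.
  by case: (eqVneq z x) => [->|_]; last case: (eqVneq z y) => [->|_];
    rewrite ?xU ?yU.
(* [x] comes first: at index 0 the first entry of the maximum is [#|U|], which allows [W = U]. *)
have [xS|xS] := boolP (x \in S).
  exists U, x; split=> //; first by rewrite subUset sub1set vU.
  by rewrite /= eqxx subn0 leq_maxl.
(* [y] comes last, at index [#|U| - 1], where the second entry of the maximum is [#|U|]. *)
have [yS|yS] := boolP (y \in S).
  exists U, y; split=> //; first by rewrite subUset sub1set vU.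
  rewrite /= (negbTE nxy) -cats1 index_cat (negbTE ys) /= eqxx addn0 sz cardU'.
  by rewrite leq_maxr.
have sSU' : S \subset U'.
  apply/subsetP => z zS; rewrite !inE (subsetP sSU) // andbT negb_or.
  by apply/andP; split; apply: contraTneq zS => ->.
have idx a : a \in S -> index a (x :: rcons s y) = (index a s).+1.
  move=> aS; have /(subsetP sSU') aU' := aS.
  rewrite /= -cats1 index_cat sE aU'; case: eqP => // xa.
  by rewrite xa aS in xS.
have [vU'|vU'] := boolP (v \in U').
  have [W [a [cW sW aS leW]]] := peel S v sSU' S0 vU'.
  by exists W, a; split; rewrite ?idx // cardU' ltnW // maxn_shift.
(* Here [v] is one of the two removed leaves. Its neighbour [z] stands in for it, and attaching [v]
   afterwards still omits the other leaf. *)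
have [z zU' evz] : exists2 z, z \in U' & e v z.
  have /set0Pn[b /(subsetP sSU') bU'] := S0.
  apply: (conn_attach (s := b)) => //.
  have vxy : (v == x) || (v == y).
    by move: vU'; rewrite !inE vU andbT negbK.
  case/orP: vxy => /eqP ->.
  (* Putting one leaf back gives [U] without the other leaf, which is connected. *)
  - suff -> : x |: U' = U :\ y by apply: connD1.
    apply/setP => w; rewrite !inE.
    by have [->|_] := eqVneq w x; rewrite ?xU ?nxy //.
  - suff -> : y |: U' = U :\ x by apply: connD1.
    apply/setP => w; rewrite !inE; have [->|_] := eqVneq w y.
      by rewrite yU eq_sym nxy.
    by rewrite orbF.
have [W [a [cW sW aS leW]]] := peel S z sSU' S0 zU'.
exists (v |: W), a; split=> //.
- apply: connU1 cW _ evz; apply: subsetP sW _ _; exact: setU11.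
- by rewrite setUS // (subset_trans _ sW) // subsetUr.
- rewrite idx // cardsU1 cardU'; apply: leq_trans (maxn_shift leW).
  by case: (v \in W); rewrite /= ?add0n ?add1n.
Qed.

End InducedConnectivity.

(** * Induced subtrees and the upper bound on the Steiner distance *)

Section TreeEdges.

Variables (V : finType) (E : {set {set V}}).
Implicit Types W S : {set V}.
Hypothesis E2 : forall A, A \in E -> #|A| = 2.
Hypothesis E_acyclic : acyclic_graph E.

Definition induced_edges W : {set {set V}} := [set A in E | A \subset W].

Lemma adj_sym : symmetric (adj E).
Proof. by move=> x y; rewrite /adj /= setUC. Qed.

Lemma adj_irr : irreflexive (adj E).
Proof.
move=> x; apply/negP => /E2; rewrite setUid cards1.
by [].
Qed.

Lemma adj_acyclic (c : seq V) : 2 < size c -> ~~ ucycleb (adj E) c.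
Proof.
move=> szc; apply: contra E_acyclic => Uc.
have /andP[_ /card_uniqP Ucc] := Uc.
have lec : size c < #|V|.+1 by rewrite ltnS -Ucc max_card.
apply/existsP; exists (Ordinal lec).
by apply/existsP; exists (in_tuple c); rewrite szc.
Qed.

(** Induction on [#|W|]: deleting a leaf removes one vertex and at most one edge. *)
Lemma card_induced_edges W :
  conn (adj E) W -> W != set0 -> #|induced_edges W| < #|W|.
Proof.
have [n] := ubnP #|W|; elim: n W => // n IHn W ltWn cW W0.
have [W1|W2] := leqP #|W| 1.
  rewrite (_ : induced_edges W = set0) ?cards0 ?card_gt0 //.
  apply/setP => A; rewrite !inE; apply/negP => /andP[/E2 A2 /subset_leq_card].
  by rewrite A2; move: W1; lia.
have [x [_ [xW _ _ dx _]]] :=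
  exists_two_leaves adj_sym adj_irr adj_acyclic cW W2.
have cardW := cardsD1 x W; rewrite xW in cardW.
have lt' : #|induced_edges (W :\ x)| < #|W :\ x|.
  apply: IHn; first by move: ltWn cardW; lia.
  - by apply: connD1 => //; exact: adj_sym.
  - by rewrite -card_gt0; move: W2 cardW; lia.
suff sub : induced_edges W \subset
    induced_edges (W :\ x) :|: [set [set x; y] | y in nbr (adj E) W x].
  rewrite cardW add1n ltnS (leq_trans (subset_leq_card sub)) //.
  rewrite (leq_trans (leq_card_setU _ _).1) //; apply: leq_trans lt'.
  by rewrite -addn1 leq_add2l (leq_trans (leq_imset_card _ _)).
apply/subsetP => A; rewrite !inE => /andP[AE sAW]; rewrite AE /= subsetD1 sAW.
have [xA|//] := boolP (x \in A); rewrite andbF /=.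
have /eqP/cards2P[a [b [nab Aab]]] := E2 AE.
have [y yA AE'] : exists2 y, y \in A & A = [set x; y].
  move: xA; rewrite Aab => /set2P[] ->.
  - by exists b; rewrite ?set22.
  - by exists a; rewrite ?set21 // setUC.
apply/imsetP; exists y => //.
by rewrite inE (subsetP sAW) // /adj /= -AE'.
Qed.

(** The subgraph induced on [W] is one of the subtrees over which the minimum is taken, and it has
    fewer edges than vertices. *)
Lemma steiner_dist_lt S W :
  conn (adj E) W -> W != set0 -> S \subset W -> steiner_dist E S < #|W|.
Proof.
move=> cW W0 sSW; apply: leq_ltn_trans (card_induced_edges cW W0).
have sWE : induced_edges W \subset E.
  by apply/subsetP => A; rewrite inE => /andP[].
rewrite /steiner_dist.
pose H0 := (W, induced_edges W).
have PH0 : is_subtree E H0.1 H0.2 && (S \subset H0.1).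
  rewrite sSW andbT /is_subtree sWE /is_tree W0 /=; apply/and3P; split.
  - apply/forall_inP => A; rewrite inE => /andP[AE ->].
    by rewrite (E2 AE).
  - apply/forall_inP => x xW; apply/forall_inP => y yW.
    apply: connect_sub (cW x y xW yW) => a b /and3P[aW bW eab].
    by apply: connect1; rewrite /adj /= inE subUset !sub1set aW bW !andbT.
  - apply: contra E_acyclic => /existsP[m /existsP[c /andP[szc /andP[cc Uc]]]].
    apply/existsP; exists m; apply/existsP; exists c.
    rewrite szc /ucycleb Uc andbT.
    by apply: sub_cycle cc => a b; apply: (subsetP sWE).
exact: (Order.TotalTheory.bigmin_le_cond #|E|
  (fun H : {set V} * {set {set V}} => #|H.2|) PH0).
Qed.

Lemma steiner_ecc_le k S d :
  (forall S' : {set V}, S \subset S' -> #|S'| = k -> steiner_dist E S' <= d) ->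
  steiner_ecc k E S <= d.
Proof.
by move=> le_d; apply/bigmax_leqP => S' /andP[sSS' /eqP]; apply: le_d.
Qed.

End TreeEdges.

(** * Brooms *)

Section Broom.

Variables (n p : nat).
Hypothesis p_gt1 : 1 < p.
Implicit Types (S : {set 'I_n}) (F : {set {set 'I_n}}).

(* The component not containing the centre of the broom minus the edge from c
   to its parent. *)
Definition below (c v : nat) : bool := if c < p then v == c else c <= v.

(** The broom is rooted at its centre 0, which by convention is its own parent. *)
Definition parent_val (c : nat) : nat := if c <= p then 0 else c.-1.

Lemma parent_subproof (c : 'I_n) : parent_val c < n.
Proof. by have := ltn_ord c; rewrite /parent_val; case: ifP; lia. Qed.

Definition parent (c : 'I_n) : 'I_n := Ordinal (parent_subproof c).

(** The non-root vertices whose parent edge separates two members of [S]. These edges make up the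
    minimal subtree containing [S], so their number stands for its Steiner distance. *)
Definition crossing S : {set 'I_n} :=
  [set c : 'I_n | [&& 0 < c, [exists u in S, below c u]
                           & [exists u in S, ~~ below c u]]].

Lemma crossingP S (c u v : 'I_n) : 0 < c -> u \in S -> v \in S ->
  below c u -> ~~ below c v -> c \in crossing S.
Proof.
move=> c0 uS vS bu bv; rewrite inE c0 /=; apply/andP; split.
- by apply/exists_inP; exists u.
- by apply/exists_inP; exists v.
Qed.

Lemma broom_edge_cut (c i j : 'I_n) : 0 < c -> broom_edge p i j ->
  below c i != below c j -> (i = parent c) /\ (j = c).
Proof.
move=> c0 eij cut; suff: (i = parent_val c :> nat) /\ (j = c :> nat).
  by case=> ? ?; split; apply: val_inj.
by move: eij cut; rewrite /broom_edge /below /parent_val; do 2 case: ifP; lia.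
Qed.

(** A walk that leaves [below c] must use a broom edge across this cut, and the parent edge of [c]
    is the only one. *)
Lemma parent_edge_in F (c u v : 'I_n) : F \subset broom n p -> 0 < c ->
  connect (adj F) u v -> below c u -> ~~ below c v -> [set parent c; c] \in F.
Proof.
move=> sFB c0 /connectP[q pth ->] {v}.
elim: q u pth => [|w q IHq] u /=; first by move=> _ ->.
case/andP; rewrite {1}/adj /= => uwF pth bu bl.
have [bw|bw] := boolP (below c w); first exact: IHq pth bw bl.
have := subsetP sFB _ uwF; rewrite inE.
case/existsP=> i /existsP[j /andP[eij /eqP uw]].
have cut : below c i != below c j.
  have /set2P uij : u \in [set i; j] by rewrite -uw set21.
  have /set2P wij : w \in [set i; j] by rewrite -uw set22.
  have nuw : below c u != below c w by rewrite bu (negbTE bw).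
  by case: uij nuw => ->; case: wij => -> //; rewrite ?eqxx // eq_sym.
by have [<- <-] := broom_edge_cut c0 eij cut; rewrite -uw.
Qed.

(** If distinct [c] and [d] shared their edge, each would be the parent of the other, but parents
    have smaller labels. *)
Lemma parent_edge_inj : {in [set c : 'I_n | 0 < c] &,
  injective (fun c => [set parent c; c])}.
Proof.
move=> c d; rewrite !inE => c0 d0 eq_cd.
have : c \in [set parent d; d] by rewrite -eq_cd set22.
have : d \in [set parent c; c] by rewrite eq_cd set22.
move=> /set2P[dE|-> //] /set2P[cE|//].
move/(congr1 val): dE; move/(congr1 val): cE.
by rewrite /= /parent_val; do 2 case: ifP; lia.
Qed.

Lemma card_crossing_le S F :
  {in crossing S, forall c, [set parent c; c] \in F} -> #|crossing S| <= #|F|.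
Proof.
move=> sF.
rewrite -(card_in_imset (f := fun c => [set parent c; c])); last first.
  by move=> c d; rewrite !inE => /andP[c0 _] /andP[d0 _];
    apply: parent_edge_inj; rewrite inE.
by apply/subset_leq_card/subsetP => _ /imsetP[c cS ->]; apply: sF.
Qed.

Lemma crossing_le_dist S : #|crossing S| <= steiner_dist (broom n p) S.
Proof.
(* The first goal is the default value, the number of all broom edges; the second is an arbitrary
   subtree containing [S]. *)
apply: (@Order.POrderTheory.le_bigmin _ nat) => [|[W F] /=].
  apply: card_crossing_le => c; rewrite inE => /andP[c0 _].
  rewrite inE; apply/existsP; exists (parent c); apply/existsP; exists c.
  by rewrite eqxx andbT /broom_edge /= /parent_val; case: ifP; lia.
case/andP=> /andP[sFB /and4P[_ _ /forall_inP cF _]] sSW.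
apply: card_crossing_le => c.
rewrite inE => /and3P[c0 /exists_inP[u uS bu] /exists_inP[v vS bv]].
have /forall_inP cFu := cF u (subsetP sSW u uS).
exact: parent_edge_in sFB c0 (cFu v (subsetP sSW v vS)) bu bv.
Qed.

Lemma crossing_le_ecc k S S' : S \subset S' -> #|S'| = k ->
  #|crossing S'| <= steiner_ecc k (broom n p) S.
Proof.
move=> sSS' cardS'; apply: leq_trans (crossing_le_dist S') _.
by apply: leq_bigmax_cond; rewrite sSS' cardS' eqxx.
Qed.

Lemma card_ord_itv (a b : nat) : b <= n ->
  #|[set c : 'I_n | a <= c < b]| = b - a.
Proof.
move=> leb; rewrite -[b - a]muln1 -sum_nat_const_nat.
rewrite (big_nat_widenl a 0) // (big_nat_widen 0 b n) //.
by rewrite big_mkord sum1dep_card.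
Qed.

(** [a.+1 - p] is the position of [a] on the path 0, [p], [p + 1], ..., counted from 0. Every path
    edge beyond [a] separates [a] from the far end [w]. *)
Lemma card_crossing_last S (a w : 'I_n) :
  a \in S -> w \in S -> w = n.-1 :> nat ->
  a = 0 :> nat \/ p <= a -> n - p - (a.+1 - p) <= #|crossing S|.
Proof.
move=> aS wS wn a_path.
have ->: n - p - (a.+1 - p) = n - maxn a.+1 p by lia.
rewrite -(card_ord_itv _ (leqnn n)); apply/subset_leq_card/subsetP => c.
rewrite inE ltn_ord andbT geq_max => /andP[ac pc].
apply: (crossingP (u := w) (v := a)) => //; first lia.
- by rewrite /below; have := ltn_ord c; case: ifP; lia.
- by rewrite /below; case: ifP; lia.
Qed.

(** The path edges between the centre and [a] are crossed, and so is the edge of the pendant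
    neighbour [w], which gives the extra one. *)
Lemma card_crossing_pendant S (a w : 'I_n) :
  a \in S -> w \in S -> w = 1 :> nat ->
  a = 0 :> nat \/ p <= a -> (a.+1 - p).+1 <= #|crossing S|.
Proof.
move=> aS wS w1 a_path; rewrite -(card_ord_itv p (ltn_ord a)).
have wN : w \notin [set c : 'I_n | p <= c < a.+1] by rewrite inE w1; lia.
rewrite (_ : _.+1 = #|w |: [set c : 'I_n | p <= c < a.+1]|); last first.
  by rewrite cardsU1 wN.
apply/subset_leq_card/subsetP => c /setU1P[->|].
  apply: (crossingP (u := w) (v := a)) => //;
    by rewrite /below ?w1 ?p_gt1 //; lia.
rewrite inE => /andP[pc ca].
apply: (crossingP (u := a) (v := w)) => //;
  by rewrite /below; do ?case: ifP; lia.
Qed.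

(** For [p < n] these are the leaves of the broom: the pendant neighbours of the centre and the far
    end of the path. *)
Definition broom_leaves : {set 'I_n} :=
  [set j : 'I_n | (0 < j < p) || (j == n.-1 :> nat)].

(** A second leaf in [S] is pendant at the centre, so the whole path is crossed; each leaf of [S]
    other than the far end [w] adds its own edge. *)
Lemma card_crossing_leaves S (w : 'I_n) : p < n -> w \in S -> w = n.-1 :> nat ->
  1 < #|S :&: broom_leaves| ->
  n - p + #|S :&: broom_leaves| <= #|crossing S|.+1.
Proof.
move=> ltpn wS wn.
have wB : w \in S :&: broom_leaves by rewrite !inE wS wn eqxx orbT.
rewrite (cardsD1 w) wB add1n ltnS addnS ltnS => /card_gt0P[u].
rewrite !inE => /and3P[uw uS uB].
have u0p : 0 < u < p.
  case/orP: uB => // /eqP un; case/eqP: uw.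
  by apply: val_inj; rewrite /= un wn.
rewrite -(card_ord_itv p (leqnn n)).
rewrite (_ : #|_| + #|_| =
  #|[set c : 'I_n | p <= c < n] :|: (S :&: broom_leaves) :\ w|); last first.
  rewrite cardsU (_ : _ :&: (_ :\ w) = set0) ?cards0 ?subn0 //.
  apply/setP => c; rewrite !inE; apply/negP.
  case/andP=> /andP[pc _] /and3P[cw _ /orP[]]; first lia.
  by move=> /eqP cn; case/eqP: cw; apply: val_inj; rewrite /= cn wn.
apply/subset_leq_card/subsetP => c /setUP[].
  rewrite inE => /andP[pc _]; have /andP[u0 up] := u0p.
  apply: (crossingP (u := w) (v := u)) => //; rewrite /below; have := ltn_ord c;
   by do ?case: ifP; lia.
case/setD1P=> cw /setIP[cS]; rewrite inE => cB.
have {}cw : c <> w :> nat by move=> /val_inj /eqP; rewrite (negbTE cw).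
apply: (crossingP (u := c) (v := w)) => //; rewrite /below; first lia.
  by rewrite eqxx leqnn if_same.
by case: ifP; lia.
Qed.

(** All labels are below [p], so each member of [S] except possibly the centre is cut off from the
    others by its own edge. *)
Lemma card_crossing_star S : n <= p -> 1 < #|S| -> #|S| <= #|crossing S|.+1.
Proof.
move=> lenp S1; have /card_gt0P[a0 _] : 0 < #|S| by lia.
have n0 : 0 < n := leq_ltn_trans (leq0n a0) (ltn_ord a0).
rewrite (cardsD1 (Ordinal n0)).
apply: leq_trans (_ : #|S :\ Ordinal n0|.+1 <= _).
  by case: (_ \in S).
rewrite ltnS; apply/subset_leq_card/subsetP => c /setD1P[c0 cS].
have [v vS vc] : exists2 v, v \in S & v != c.
  move: S1; rewrite (cardsD1 c) cS ltnS => /card_gt0P[v].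
  by rewrite !inE => /andP[vc vS]; exists v.
have cp : c < p := leq_trans (ltn_ord c) lenp.
have cpos : 0 < c.
  by rewrite lt0n; apply: contra c0 => /eqP c0; apply/eqP/val_inj.
by apply: (crossingP cpos cS vS); rewrite /below cp.
Qed.

End Broom.

(** * Trees *)

(* The labels 0, p, ..., n - 2 of the inner vertices of the broom, in path
   order, receive the enumeration s. *)
Lemma exists_broom_labelling (T : finType) (L : {set T}) (s : seq T) :
  uniq s -> s =i ~: L -> 0 < size s -> 1 < #|L| ->
  exists f : 'I_#|T| -> T, [/\ injective f,
    forall i, (f i \in L) = (i \in broom_leaves #|T| #|L|) &
    forall i, f i \notin L -> index (f i) s = i.+1 - #|L|].
Proof.
move=> Us sE; case: s Us sE => // s0 s1 Us sE _ L1.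
have := cardE L; have := enum_uniq L; have := mem_enum L.
case/lastP: (enum L) => [|l1 z] LE Ul szL; first by rewrite szL in L1.
rewrite size_rcons in szL.
have cardT : #|T| = size l1 + (size s1).+2.
  have := cardC L; rewrite szL.
  have <- : size (s0 :: s1) = #|[predC L]|.
    by rewrite -(card_uniqP Us); apply: eq_card => x; rewrite sE !inE.
  by move=> <- /=; lia.
(* The vertices in label order: [s0] at the centre, all leaves but one at 1, ..., [p - 1], the
   remaining inner vertices along the path, the last leaf [z] at its far end. *)
pose t := s0 :: l1 ++ rcons s1 z.
have szt : size t = #|T| by rewrite /= size_cat size_rcons cardT; lia.
have sNL x : x \in s0 :: s1 -> x \notin L by rewrite sE inE.
have l1L x : x \in l1 -> x \in L.
  by rewrite -LE mem_rcons inE => ->; rewrite orbT.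
have zL : z \in L by rewrite -LE mem_rcons mem_head.
have Ut : uniq t.
  have : perm_eq t ((s0 :: s1) ++ rcons l1 z).
    by apply/permP => a; rewrite /t /= -!cats1 !count_cat; lia.
  move/perm_uniq->; rewrite cat_uniq Us Ul andbT /=.
  apply/hasPn => x; rewrite LE => xL; apply: contraL xL => /sNL; by [].
exists (fun i => nth s0 t i); split.
- move=> i j /eqP; rewrite nth_uniq ?szt // => /eqP; exact: val_inj.
- move=> [i lti]; rewrite inE /= szL [#|T|]cardT.
  have {}lti : i < size l1 + (size s1).+2 by rewrite -cardT.
  case: i lti => [|i] lti /=.
    by rewrite (negbTE (sNL s0 (mem_head _ _))); lia.
  rewrite nth_cat; case: ltnP => il.
    by rewrite l1L ?mem_nth //; lia.
  rewrite nth_rcons; case: ltnP => is1.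
    have /sNL/negbTE-> : nth s0 s1 (i - size l1) \in s0 :: s1.
      by rewrite inE mem_nth ?orbT.
    by lia.
  have -> : i - size l1 == size s1 by lia.
  by rewrite zL; lia.
- move=> [i lti] /=; rewrite szL.
  have {}lti : i < size l1 + (size s1).+2 by rewrite -cardT.
  case: i lti => [|i] lti /=; first by rewrite eqxx; lia.
  rewrite nth_cat; case: ltnP => il; first by rewrite l1L ?mem_nth.
  rewrite nth_rcons; case: ltnP => is1; last first.
    by have -> : i - size l1 == size s1; [lia | rewrite zL].
  have /andP[s0N Us1] := Us => _.
  have xs1 : nth s0 s1 (i - size l1) \in s1 by rewrite mem_nth.
  by rewrite ifN ?index_uniq //; [lia | apply: contraNneq s0N => ->].
Qed.

(** * Upper bounds on Steiner distances in the given tree *)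

Section Tree.

Variables (V : finType) (E : {set {set V}}).
Hypothesis hT : is_tree [set: V] E.
Hypothesis leaves_gt1 : 1 < #|leaves E|.
Local Notation p := #|leaves E|.
Local Notation n := #|V|.
Local Notation inner := (~: leaves E).
Implicit Types S : {set V}.

Let E2 A : A \in E -> #|A| = 2.
Proof. by case/and4P: hT => _ /forall_inP gE _ _ /gE /andP[/eqP]. Qed.

Let E_acyclic : acyclic_graph E.
Proof. by case/and4P: hT. Qed.

Lemma conn_unpruned (R : {set V}) : R \subset leaves E -> conn (adj E) (~: R).
Proof.
move=> sRL; rewrite -setTD; apply: connD => [|x y _ _|x xR].
- exact: adj_sym.
- case/and4P: hT => _ _ /forall_inP cE _.
  have /forall_inP/(_ y (in_setT y)) := cE x (in_setT x).
  apply: connect_sub => a b eab; apply: connect1.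
  by rewrite /restrict_rel /= !inE.
- have := subsetP sRL x xR; rewrite inE => /eqP <-.
  by apply: subset_leq_card; apply/subsetP => y; rewrite !inE.
Qed.

(** Deleting the leaves outside [S] leaves a subtree that still contains [S]. *)
Lemma dist_le_leaves S :
  S != set0 -> steiner_dist E S + p < n + #|S :&: leaves E|.
Proof.
move=> /set0Pn[x xS]; pose W := ~: (leaves E :\: S).
have sSW : S \subset W by apply/subsetP => y yS; rewrite !inE yS.
have W0 : W != set0 by apply/set0Pn; exists x; apply: (subsetP sSW).
have := steiner_dist_lt E2 E_acyclic (conn_unpruned (subsetDl _ _)) W0 sSW.
have cardW : #|W| + #|leaves E :\: S| = n by rewrite -[in RHS](cardsC W) setCK.
have cardL : #|S :&: leaves E| + #|leaves E :\: S| = p by rewrite setIC cardsID.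
move=> lt_dist.
by rewrite -cardW -cardL addnA [ltnRHS]addnAC ltn_add2r ltn_add2r.
Qed.

(** This peels the inner tree. A leaf [v] is replaced by its inner neighbour and attached at the
    end; the vertex this costs is made up for by a subtree having fewer edges than vertices. *)
Lemma exists_inner_order : exists s : seq V,
  [/\ uniq s, s =i inner & forall S v, S \subset inner -> S != set0 ->
    exists2 a, a \in S &
      steiner_dist E (v |: S) <= maxn (n - p - index a s) (index a s).+1].
Proof.
have [s [Us sE peel]] := exists_peeling (@adj_sym V E) (adj_irr E2)
  (adj_acyclic E_acyclic) (conn_unpruned (subxx _)).
have cardI : #|inner| = n - p by have := cardsC (leaves E); lia.
exists s; split=> // S v sSI S0.
have [x xS] := set0Pn _ S0.
have [vI|vL] := boolP (v \in inner).
  have [W [a [cW sW aS leW]]] := peel S v sSI S0 vI.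
  exists a => //; rewrite -cardI; apply: leq_trans leW; apply: ltnW.
  apply: (steiner_dist_lt E2 E_acyclic) => //; apply/set0Pn; exists v.
  exact: subsetP sW _ (setU11 _ _).
have [z zI evz] : exists2 z, z \in inner & adj E v z.
  apply: (conn_attach (adj_irr E2) _ vL (subsetP sSI x xS)).
  suff -> : v |: inner = ~: (leaves E :\ v) by apply/conn_unpruned/subD1set.
  by apply/setP => y; rewrite !inE negb_and negbK.
have [W [a [cW sW aS leW]]] := peel S z sSI S0 zI.
have [zW sSW] : z \in W /\ S \subset W.
  by move: sW; rewrite subUset sub1set => /andP[].
exists a => //; rewrite -cardI; apply: leq_trans leW.
suff : steiner_dist E (v |: S) < #|v |: W|.
  by rewrite cardsU1; case: (v \in W); rewrite /= ?add0n ?add1n // => /ltnW.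
apply: (steiner_dist_lt E2 E_acyclic) => //; last exact: setUS.
- exact: (@connU1 _ _ (@adj_sym V E) _ _ _ cW zW evz).
- by apply/set0Pn; exists v; apply: setU11.
Qed.

Lemma card_leaves_extension S S' : S \subset S' ->
  #|S' :&: leaves E| <= #|S :&: leaves E| + (#|S'| - #|S|).
Proof.
move=> sSS'; rewrite -[#|S'| - _](_ : #|S' :\: S| = _); last first.
  by rewrite cardsD (setIidPr sSS').
apply: leq_trans (leq_card_setU _ _).1; apply/subset_leq_card/subsetP => x.
by rewrite !inE => /andP[-> ->]; rewrite !andbT orbN.
Qed.

(** The case where every vertex is a leaf: [k - 1] bounds the distance of each [k]-set from above in
    the tree and from below in the broom. *)
Lemma ecc_le_broom_star k (S : {set 'I_n}) (f : 'I_n -> V) :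
  n <= p -> 1 < k <= n -> #|S| <= k ->
  steiner_ecc k E (f @: S) <= steiner_ecc k (broom n p) S.
Proof.
move=> lenp /andP[k1 kn] Sk; apply: steiner_ecc_le => S' _ cardS'.
have [|Z [sSZ _ cardZ]] := subset_card_between (subsetT S) Sk.
  by rewrite cardsT card_ord.
apply: leq_trans (crossing_le_ecc leaves_gt1 sSZ cardZ).
have S'0 : S' != set0 by rewrite -card_gt0 cardS' ltnW.
have lt_dist : steiner_dist E S' < k.
  rewrite -(ltn_add2r p) (leq_trans (dist_le_leaves S'0)) //.
  by rewrite addnC leq_add // -cardS' subset_leq_card ?subsetIl.
rewrite -ltnS (leq_trans lt_dist) // -cardZ.
by apply: card_crossing_star; rewrite ?cardZ.
Qed.

(** * Comparison with the broom through a leaf-preserving labelling *)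

Section Labelled.

Variable f : 'I_n -> V.
Hypothesis f_inj : injective f.
Hypothesis f_leaves : forall i, (f i \in leaves E) = (i \in broom_leaves n p).
Hypothesis p_lt_n : p < n.
Implicit Type X Z : {set 'I_n}.
Local Notation BL := (broom_leaves n p).

Lemma card_leaves_imset X : #|f @: X :&: leaves E| = #|X :&: BL|.
Proof.
rewrite -(card_imset _ f_inj); apply: eq_card => x; rewrite inE.
apply/andP/imsetP => [[/imsetP[i iX ->]]|[i /setIP[iX iL] ->]].
  by rewrite f_leaves => iL; exists i; rewrite // inE iX.
by rewrite imset_f // f_leaves.
Qed.

Let tip_subproof : n.-1 < n. Proof. by move: p_lt_n; clear; lia. Qed.
Let tip : 'I_n := Ordinal tip_subproof.

Let tipE : tip = n.-1 :> nat. Proof. by []. Qed.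

Let pendant_subproof : 1 < n.
Proof. exact: leq_trans leaves_gt1 (ltnW p_lt_n). Qed.
Let pendant : 'I_n := Ordinal pendant_subproof.

Let tipBL : tip \in BL.
Proof. by rewrite inE /= eqxx orbT. Qed.

Let pendantBL : pendant \in BL.
Proof. by rewrite inE /= leaves_gt1. Qed.

Lemma card_broom_leaves : #|BL| = p.
Proof.
have tipN : tip \notin [set c : 'I_n | 1 <= c < p].
  by rewrite inE tipE; move: p_lt_n; clear; lia.
have -> : BL = tip |: [set c : 'I_n | 1 <= c < p].
  by apply/setP => c; rewrite !inE orbC.
rewrite cardsU1 tipN card_ord_itv ?(ltnW p_lt_n) //.
by rewrite add1n subn1 prednK // ltnW.
Qed.

(** The set is filled up with leaves first, [tip] among them: either only leaves are added, or all
    leaves of the broom get in. *)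
Lemma exists_leafy_extension k X : #|X| < k <= n ->
  exists Z, [/\ X \subset Z, #|Z| = k, tip \in Z &
    minn p (#|X :&: BL| + (k - #|X|)) <= #|Z :&: BL|].
Proof.
case/andP=> ltXk lekn; have [le_k|lt_k] := leqP k #|X :|: BL|.
  have [||Z [sXZ sZXB cardZ]] :=
    @subset_card_between _ (tip |: X) (X :|: BL) k _ _ le_k.
  - by rewrite subUset sub1set inE tipBL orbT subsetUl.
  - by rewrite cardsU1; apply: leq_trans ltXk; rewrite -add1n leq_add2r leq_b1.
  move: sXZ; rewrite subUset sub1set => /andP[tipZ sXZ]; exists Z; split=> //.
  rewrite geq_min; apply/orP; right.
  have <- : #|Z :\: X| = k - #|X| by rewrite cardsD (setIidPr sXZ) cardZ.
  have <- : #|(X :&: BL) :|: (Z :\: X)| = #|X :&: BL| + #|Z :\: X|.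
    rewrite cardsU (_ : _ :&: (Z :\: X) = set0) ?cards0 ?subn0 //.
    by apply/setP => c; rewrite !inE; case: (c \in X); rewrite ?andbF.
  apply/subset_leq_card/subsetP => c; rewrite !inE.
  case/orP=> [/andP[cX ->]|/andP[cX cZ]].
    by rewrite (subsetP sXZ).
  by have := subsetP sZXB c cZ; rewrite !inE (negbTE cX) cZ.
have [|Z [sUZ _ cardZ]] := subset_card_between (subsetT (X :|: BL)) (ltnW lt_k).
  by rewrite cardsT card_ord.
move: sUZ; rewrite subUset => /andP[sXZ sBZ]; exists Z; split=> //.
- exact: subsetP sBZ _ tipBL.
- by rewrite geq_min (setIidPr sBZ) card_broom_leaves leqnn.
Qed.

(** The extension [Z] has at least as many leaves as any extension [S'] in the tree, and at least
    two, so its crossing edges reach the bound of [dist_le_leaves]. *)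
Lemma ecc_le_broom_leafy k X : #|X| < k <= n -> 1 < #|X :&: BL| + (k - #|X|) ->
  steiner_ecc k E (f @: X) <= steiner_ecc k (broom n p) X.
Proof.
move=> Xk leafy; have [Z [sXZ cardZ tipZ leZ]] := exists_leafy_extension Xk.
apply: steiner_ecc_le => S' sXS' cardS'.
apply: leq_trans (crossing_le_ecc leaves_gt1 sXZ cardZ).
have Z1 : 1 < #|Z :&: BL| by rewrite (leq_trans _ leZ) // leq_min leaves_gt1.
rewrite -ltnS.
apply: leq_trans (card_crossing_leaves leaves_gt1 p_lt_n tipZ tipE Z1).
have S'0 : S' != set0.
  by rewrite -card_gt0 cardS'; case/andP: Xk => /(leq_ltn_trans (leq0n _)).
rewrite -(ltn_add2r p) addnAC (subnK (ltnW p_lt_n)).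
apply: leq_trans (dist_le_leaves S'0) _; rewrite leq_add2l (leq_trans _ leZ) //.
rewrite leq_min subset_leq_card ?subsetIr // -card_leaves_imset.
by rewrite -cardS' -(card_imset (mem X) f_inj) card_leaves_extension.
Qed.

Variable s : seq V.
Hypothesis index_f : forall i, f i \notin leaves E -> index (f i) s = i.+1 - p.
Hypothesis s_dist : forall S v, S \subset inner -> S != set0 ->
  exists2 a, a \in S &
    steiner_dist E (v |: S) <= maxn (n - p - index a s) (index a s).+1.

(** Only one vertex is added. For the [a] supplied by [s_dist], adding [tip] to [X] reaches the
    first entry of the maximum and adding [pendant] the second. *)
Lemma ecc_le_broom_inner X : X != set0 -> X :&: BL = set0 ->
  steiner_ecc #|X|.+1 E (f @: X) <= steiner_ecc #|X|.+1 (broom n p) X.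
Proof.
move=> X0 XBL; have XN i : i \in X -> i \notin BL.
  move=> iX; apply/negP => iL; have : i \in X :&: BL by rewrite inE iX.
  by rewrite XBL inE.
apply: steiner_ecc_le => S' sXS' cardS'.
have /cards1P[v vE] : #|S' :\: f @: X| == 1.
  by rewrite cardsD (setIidPr sXS') cardS' (card_imset _ f_inj) subSnn.
have -> : S' = v |: f @: X.
  by rewrite -vE setUC setDE setUIr setUCr setIT; apply/esym/setUidPr.
have [||_ /imsetP[a aX ->]] := @s_dist (f @: X) v.
- by apply/subsetP => _ /imsetP[i iX ->]; rewrite inE f_leaves XN.
- by have /set0Pn[i iX] := X0; apply/set0Pn; exists (f i); apply: imset_f.
rewrite index_f ?f_leaves ?XN // => /leq_trans; apply.
have a_path : a = 0 :> nat \/ p <= a.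
  by have := XN a aX; rewrite inE; clear; lia.
rewrite geq_max; apply/andP; split.
- apply: leq_trans (crossing_le_ecc leaves_gt1 (subsetUr [set tip] X) _).
    exact: (card_crossing_last leaves_gt1 (setU1r _ aX) (setU11 _ _)).
  by rewrite cardsU1 (contraL (XN tip)) ?tipBL.
- apply: leq_trans (crossing_le_ecc leaves_gt1 (subsetUr [set pendant] X) _).
    exact: (card_crossing_pendant leaves_gt1 (setU1r _ aX) (setU11 _ _)).
  by rewrite cardsU1 (contraL (XN pendant)) ?pendantBL.
Qed.

End Labelled.

Lemma exists_ecc_le_broom k : 1 < k <= n ->
  exists2 f : 'I_n -> V, injective f & forall X : {set 'I_n}, #|X| < k ->
    steiner_ecc k E (f @: X) <= steiner_ecc k (broom n p) X.
Proof.
move=> k_range; have [lenp|ltpn] := leqP n p.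
  exists (@enum_val V predT) => [|X ltXk]; first exact: enum_val_inj.
  exact: ecc_le_broom_star lenp k_range (ltnW ltXk).
have [s [Us sE s_dist]] := exists_inner_order.
have s_gt0 : 0 < size s.
  have : 0 < #|inner| by move: ltpn; have := cardsC (leaves E); clear; lia.
  by case/card_gt0P=> x; rewrite -sE; case: (s).
have [f [f_inj f_leaves index_f]] :=
  exists_broom_labelling Us sE s_gt0 leaves_gt1.
exists f => // X ltXk; have /andP[k1 kn] := k_range.
have [leafy|not_leafy] := ltnP 1 (#|X :&: broom_leaves n p| + (k - #|X|)).
  by apply: ecc_le_broom_leafy; rewrite ?ltXk.
(* Since [X] has fewer than [k] elements, failing to reach two leaves means that one vertex is added
   and [X] contains no leaf. *)
have kE : k = #|X|.+1 by move: not_leafy ltXk; clear; lia.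
have X0 : X != set0 by rewrite -card_gt0; move: k1; rewrite kE ltnS.
rewrite kE; apply: (ecc_le_broom_inner f_inj f_leaves ltpn index_f s_dist X0).
apply/eqP; rewrite -cards_eq0; move: not_leafy.
by rewrite kE subSnn addn1 ltnS leqn0.
Qed.

End Tree.

(** * Averaging the setwise comparison *)

Theorem theorem8 (V : finType) (E : {set {set V}}) (n p k l : nat)
    (hk : 2 <= k) (hlk : l < k) (hkn : k <= n)
    (hT : is_tree [set: V] E) (hn : #|V| = n)
    (hp : #|leaves E| = p) (hp2 : 2 <= p) :
  (avg_steiner_ecc k l E <= avg_steiner_ecc k l (broom n p))%R.
Proof.
subst n p.
have [|f f_inj f_ecc] := exists_ecc_le_broom hT hp2 (k := k).
  by rewrite hk.
rewrite /avg_steiner_ecc card_ord.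
apply: Num.Theory.ler_wpM2r.
  by rewrite Num.Theory.invr_ge0 Num.Theory.ler0n.
rewrite Num.Theory.ler_nat.
have [g fK gK] : bijective f by apply: inj_card_bij; rewrite // card_ord.
(* The bijection [f] acts on the [l]-subsets, so the two sums can be compared term by term. *)
rewrite (reindex (fun X : {set 'I_#|V|} => f @: X)) /=; last first.
  apply: onW_bij; exists (fun Y : {set V} => g @: Y) => X.
  - by rewrite -imset_comp (eq_imset _ fK) imset_id.
  - by rewrite -imset_comp (eq_imset _ gK) imset_id.
rewrite (eq_bigl (fun X : {set 'I_#|V|} => #|X| == l)) => [|X]; last first.
  by rewrite (card_imset _ f_inj).
by apply: leq_sum => X /eqP Xl; apply: f_ecc; rewrite Xl.
Qed.
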